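(* Let $p$ be a prime. For $F=\begin{pmatrix}\alpha&\beta\\ \gamma&\delta\end{pmatrix}\in SL(2,\mathbb{Z}_p)$ and $u=(u_1,u_2)\in\mathbb{Z}_p^2$ let $C_{(F|u)}=D_uU_F$ be the Clifford unitary on $\mathbb{C}^p$ described in the context, and let $$|J^F_u\rangle=(I\otimes C_{(F|u)})\frac{1}{\sqrt p}\sum_{j=0}^{p-1}|jj\rangle\in\mathbb{C}^p\otimes\mathbb{C}^p .$$ For each $F$, $\mathcal{B}_F=\{|J^F_u\rangle: u\in\mathbb{Z}_p^2\}$ is an orthonormal basis of $\mathbb{C}^p\otimes\mathbb{C}^p$. Then: (a) If $F_1,F_2\in SL(2,\mathbb{Z}_p)$ satisfy $\mathrm{Tr}(F_1^{-1}F_2)\neq 2\pmod p$, then the bases $\mathcal{B}_{F_1}$ and $\mathcal{B}_{F_2}$ are mutually unbiased, i.e. $|\langle J^{F_1}_u|J^{F_2}_v\rangle|=1/p$ for all $u,v\in\mathbb{Z}_p^2$. (b) If $\mathcal{F}=\{F_i\}\subset SL(2,\mathbb{Z}_p)$ has $|\mathcal{F}|=p^2-1$ and pairwise satisfies $\mathrm{Tr}(F_i^{-1}F_j)\neq 2\pmod p$ for $i\neq j$, then (i) $\{\mathcal{B}_{F}:F\in\mathcal{F}\}$ is a complete bipartite entangled stabilizer MUB, i.e. a set of $p^2-1$ pairwise mutually unbiased orthonormal bases of $\mathbb{C}^p\otimes\mathbb{C}^p$ consisting of maximally entangled stabilizer states, and (ii) $\mathcal{F}$ is a maximum clique of the Cayley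 graph $\Gamma(G,T)$ with $G=SL(2,\mathbb{Z}_p)$ and $T=\{F\in SL(2,\mathbb{Z}_p):\mathrm{Tr}(F)\neq 2\pmod p\}$.
   Context: Let $\omega=e^{2\pi i/p}$, $\tau=e^{(p+1)\pi i/p}$. On $\mathbb{C}^p$ with basis $\{|j\rangle\}_{j\in\mathbb{Z}_p}$ define $X|j\rangle=|j+1\rangle$, $Z|j\rangle=\omega^j|j\rangle$, and displacement operators $D_u=\tau^{u_1u_2}X^{u_1}Z^{u_2}$. For $F=\begin{pmatrix}\alpha&\beta\\ \gamma&\delta\end{pmatrix}\in SL(2,\mathbb{Z}_p)$, define $U_F=\frac{1}{\sqrt p}\sum_{j,k=0}^{p-1}\tau^{\beta^{-1}(\alpha k^2-2jk+\delta j^2)}|j\rangle\langle k|$ if $\beta\neq0$, and $U_F=\sum_{k=0}^{p-1}\tau^{\alpha\gamma k^2}|\alpha k\rangle\langle k|$ if $\beta=0$ (inverses taken mod $p$); this is Appleby's unitary implementing the symplectic action, $U_FD_vU_F^\dagger=D_{Fv}$, and $C_{(F|u)}=D_uU_F$. Two orthonormal bases $\{|a\rangle\},\{|b\rangle\}$ of a $d$-dimensional space are mutually unbiased if $|\langle a|b\rangle|=1/\sqrt d$ for all $a,b$. The Cayley graph $\Gamma(G,T)$ has vertex set $G$, with $g_1\sim g_2$ iff $g_1^{-1}g_2\in T$. A clique is a set of pairwise adjacent vertices; a maximum clique is one of largest possible size. *)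

(* Defs.v *)
(* MathComp-Analysis reals (cos, sin, pi) and the complex
   numbers R[i] of mathcomp-real-closed, matrices, and Kronecker products
   (mxtens from mathcomp-real-closed). *)
From HB Require Import structures.
From mathcomp Require Import all_boot all_order all_algebra.
From mathcomp Require Import reals trigo.
From mathcomp Require Import complex mxtens.
Unset Printing Implicit Defensive.
Import Order.TTheory GRing.Theory Num.Theory.
Local Open Scope ring_scope.
Local Open Scope complex_scope.

(* e^{i theta} *)
Definition expi (R : realType) (t : R) : R[i] := cos t +i* sin t.

(* omega = e^{2 pi i / p},  tau = e^{(p+1) pi i / p} *)
Definition omega (R : realType) (p : nat) : R[i] :=
  expi R (2 * pi / p%:R : R).
Definition tau (R : realType) (p : nat) : R[i] :=
  expi R ((p.+1)%:R * pi / p%:R : R).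

(* matrix power A^n (for square matrices of arbitrary size) *)
Definition mxpow (T : pzRingType) (n : nat) (A : 'M[T]_n) (k : nat) : 'M[T]_n :=
  iter k (mulmx A) 1%:M.
Arguments mxpow {T n} A k.

(* X|j> = |j+1>,  Z|j> = omega^j |j>  on C^p with basis |j>, j in 'I_p *)
Definition Xop (R : realType) (p : nat) : 'M[R[i]]_p :=
  \matrix_(i, j) ((nat_of_ord i == (j.+1 %% p)%N)%:R).
Definition Zop (R : realType) (p : nat) : 'M[R[i]]_p :=
  \matrix_(i, j) ((i == j)%:R * omega R p ^+ i).

(* displacement operator D_u = tau^{u1 u2} X^{u1} Z^{u2}, u in Z_p^2 *)
Definition Dop (R : realType) (p : nat) (u : 'F_p * 'F_p) : 'M[R[i]]_p :=
  tau R p ^+ (u.1 * u.2)%N *: (mxpow (Xop R p) u.1 *m mxpow (Zop R p) u.2).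

(* Appleby's unitary U_F, F = [[alpha, beta], [gamma, delta]];
   elements of Z_p are represented by their residues in {0,..,p-1}
   (including beta^{-1}), exponents of tau are computed in Z. *)
Definition Uop (R : realType) (p : nat) (F : 'M['F_p]_2) : 'M[R[i]]_p :=
  let a := F 0 0 in let b := F 0 1 in let c := F 1 0 in let d := F 1 1 in
  if b != 0 then
    \matrix_(j, k)
      ((Num.sqrt (p%:R : R))%:C^-1 *
       tau R p ^ ((nat_of_ord (b^-1))%:Z *
                  ((nat_of_ord a)%:Z * (k%:Z) ^+ 2 - 2 * j%:Z * k%:Z
                   + (nat_of_ord d)%:Z * (j%:Z) ^+ 2)))
  else
    \matrix_(j, k)
      ((nat_of_ord j == ((nat_of_ord a) * k) %% p)%N%:R *
       tau R p ^+ ((nat_of_ord a) * (nat_of_ord c) * k ^ 2)%N).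

(* Clifford unitary C_(F|u) = D_u U_F *)
Definition Cop (R : realType) (p : nat) (F : 'M['F_p]_2) (u : 'F_p * 'F_p) :=
  Dop R p u *m Uop R p F.

(* computational basis vector |j> of C^p *)
Definition ket (R : realType) (p : nat) (j : 'I_p) : 'cV[R[i]]_p := delta_mx j 0.

(* (1/sqrt p) sum_j |jj>  in C^p (x) C^p = C^(p*p) *)
Definition Phi (R : realType) (p : nat) : 'cV[R[i]]_(p * p) :=
  (Num.sqrt (p%:R : R))%:C^-1 *: \sum_(j < p) (ket R p j *t ket R p j).

(* |J^F_u> = (I (x) C_(F|u)) Phi *)
Definition Jstate (R : realType) (p : nat) (F : 'M['F_p]_2) (u : 'F_p * 'F_p)
  : 'cV[R[i]]_(p * p) :=
  ((1%:M : 'M[R[i]]_p) *t Cop R p F u) *m Phi R p.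

(* Hermitian inner product <x|y> *)
Definition dotc (R : realType) (n : nat) (x y : 'cV[R[i]]_n) : R[i] :=
  \sum_(i < n) (x i 0)^* * y i 0.

(* an orthonormal basis of C^n indexed by I *)
Definition orthonormal_basis (R : realType) (n : nat) (I : finType)
  (f : I -> 'cV[R[i]]_n) : Prop :=
  #|I| = n /\ (forall a b, dotc R n (f a) (f b) = (a == b)%:R).

(* mutually unbiased: |<a|b>| = 1/sqrt n *)
Definition mutually_unbiased (R : realType) (n : nat) (I J : finType)
  (f : I -> 'cV[R[i]]_n) (g : J -> 'cV[R[i]]_n) : Prop :=
  forall a b, `|dotc R n (f a) (g b)| = (Num.sqrt (n%:R : R))%:C^-1.

(* maximally entangled: reduced density matrix rho_A = M M^dagger = I/p,
   where M_{ij} = <ij|psi> *)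
Definition maximally_entangled (R : realType) (p : nat) (psi : 'cV[R[i]]_(p * p))
  : Prop :=
  let M : 'M[R[i]]_p := \matrix_(i, j) psi (mxtens_index (i, j)) 0 in
  M *m map_mx (fun z => z^*) M^T = (p%:R)^-1 *: 1%:M.

(* stabilizer state: a nonzero common eigenvector of p^2 distinct two-qudit
   generalized Pauli operators D_a (x) D_b *)
Definition stabilizer_state (R : realType) (p : nat) (psi : 'cV[R[i]]_(p * p))
  : Prop :=
  psi != 0 /\
  exists S : {set ('F_p * 'F_p) * ('F_p * 'F_p)},
    #|S| = (p * p)%N /\
    forall w, w \in S -> exists c : R[i],
      (Dop R p w.1 *t Dop R p w.2) *m psi = c *: psi.

(* complete bipartite entangled stabilizer MUB, indexed by a family Fam *)
Definition complete_BES_MUB (R : realType) (p : nat) (Fam : {set 'M['F_p]_2})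
  (B : 'M['F_p]_2 -> 'F_p * 'F_p -> 'cV[R[i]]_(p * p)) : Prop :=
  #|Fam| = (p ^ 2 - 1)%N /\
  (forall F, F \in Fam -> orthonormal_basis R (p * p) _ (B F)) /\
  (forall F G, F \in Fam -> G \in Fam -> F != G -> mutually_unbiased R (p * p) _ _ (B F) (B G)) /\
  (forall F u, F \in Fam -> maximally_entangled R p (B F u) /\ stabilizer_state R p (B F u)).

(* SL(2, Z_p) *)
Definition SL2 (p : nat) : {set 'M['F_p]_2} := [set F | \det F == 1].
(* T = {F in SL(2,Z_p) | Tr F <> 2} *)
Definition Tset (p : nat) : {set 'M['F_p]_2} :=
  [set F in SL2 p | \tr F != 2%:R].

(* Cayley graph adjacency: g1 ~ g2 iff g1^{-1} g2 in T *)
Definition cayley_adj (p : nat) (T : {set 'M['F_p]_2}) (g1 g2 : 'M['F_p]_2) : bool :=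
  (invmx g1 *m g2) \in T.

Definition is_clique (V : finType) (Vs : {set V}) (adj : V -> V -> bool) (K : {set V})
  : Prop :=
  K \subset Vs /\ (forall x y, x \in K -> y \in K -> x != y -> adj x y).

Definition is_maximum_clique (V : finType) (Vs : {set V}) (adj : V -> V -> bool)
  (K : {set V}) : Prop :=
  is_clique V Vs adj K /\ (forall K', is_clique V Vs adj K' -> #|K'| <= #|K|)%N.

(* Main.v *)
(* Call W a Clifford unitary over G if W D_x = c(x) D_(Gx) W for all x, with
   phases c(x).  C_(F|u) is Clifford over F, so W = C_(F1|u)^* C_(F2|v) is
   Clifford over G = F1^-1 F2, and the overlap of the two states is Tr(W) / p.
   The twirl sum_x D_x^* W D_x = p Tr(W) turns p Tr(W) W^* into a sum of phases
   times the operators D_((G-1)x).  As det(G - 1) = 2 - Tr(G) is nonzero, these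
   are p^2 distinct, hence orthogonal, operators, and comparing Hilbert-Schmidt
   norms yields |Tr(W)| = 1 without any Gauss sum and uniformly in p, 2 included.
   Two matrices F1, F2 with the same first column satisfy Tr(F1^-1 F2) = 2, so
   a clique injects into the p^2 - 1 nonzero vectors. *)

Require Import Defs.
From HB Require Import structures.
From mathcomp Require Import all_boot all_order all_algebra.
From mathcomp Require Import reals trigo.
From mathcomp Require Import complex mxtens.
From mathcomp Require Import ring lra.
Import Order.TTheory GRing.Theory Num.Theory.
Local Open Scope ring_scope.

Local Notation "A ^H" := (map_mx Num.conj A^T) (at level 2, format "A ^H").

(** * Complex exponentials on the unit circle *)

Section Phases.
Context {R : realType}.
Local Notation C := R[i].

Lemma expiD (t s : R) : expi R (t + s) = expi R t * expi R s.
Proof.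
by rewrite /expi cosD sinD; simpc; congr (_ +i* _)%C; rewrite addrC.
Qed.

Lemma expi0 : expi R 0 = 1.
Proof. by rewrite /expi cos0 sin0. Qed.

Lemma expi_mulrn (t : R) n : expi R (t *+ n) = expi R t ^+ n.
Proof.
elim: n => [|n IHn]; first by rewrite expi0 expr0.
by rewrite mulrS exprS expiD IHn.
Qed.

Lemma expi_2pi : expi R (pi *+ 2) = 1.
Proof. by rewrite /expi cos2pi sin2pi. Qed.

Lemma normr_expi (t : R) : `|expi R t| = 1.
Proof. by rewrite /expi normc_def /= cos2Dsin2 sqrtr1. Qed.

(** By the half-angle formula, cos t = 1 would force sin (t / 2) = 0, whereas t / 2 lies strictly
    between 0 and pi. *)
Lemma expi_neq1 (t : R) : 0 < t < pi *+ 2 -> expi R t != 1.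
Proof.
move=> /andP[t0 t2]; apply/eqP => /(congr1 (@complex.Re R)) /= ct.
have te : t = (t / 2) *+ 2 by rewrite -mulr_natr divfK ?pnatr_eq0.
have s0 : 0 < sin (t / 2).
  apply: sin_gt0_pi; rewrite divr_gt0 //= ltr_pdivrMr //.
  by rewrite mulr_natr.
move: ct; rewrite te cos_mulr2n cos2sin2 => h.
have : sin (t / 2) ^+ 2 = 0 by lra.
by move/eqP; rewrite sqrf_eq0 gt_eqF.
Qed.
End Phases.

(** * Characters and quadratic phases on Z_p *)

Section Weyl.
Context {R : realType} {p : nat} (hp : prime p).
Local Notation C := R[i].
Local Notation D := (Dop R p).

Let p_gt0 : (0 < p)%N := prime_gt0 hp.
Let pR_neq0 : p%:R != 0 :> R.
Proof. by rewrite pnatr_eq0 -lt0n. Qed.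

Lemma omega_expp : omega R p ^+ p = 1.
Proof.
rewrite /omega -expi_mulrn -[RHS]expi_2pi; congr expi.
by rewrite -[LHS]mulr_natr divfK // mulr_natl.
Qed.

Lemma tau_sqr : tau R p ^+ 2 = omega R p.
Proof.
(* The two angles differ by exactly one full turn. *)
rewrite /tau /omega -expi_mulrn -[RHS]mulr1 -[in RHS]expi_2pi -expiD.
congr expi; rewrite -natr1; field.
by [].
Qed.

(** The angle is p (p + 1) pi, and p (p + 1) is even. The exponent p would not do: tau^p = -1 when p
    = 2. *)
Lemma tau_exppp : tau R p ^+ (p * p) = 1.
Proof.
have /eqP e : (p * p.+1 == (p * p.+1)./2 * 2)%N.
  by rewrite muln2 eq_sym halfK oddM /= andbN subn0.
rewrite /tau -expi_mulrn.
have -> : ((p.+1)%:R * pi / p%:R : R) *+ (p * p) = (pi *+ 2) *+ (p * p.+1)./2.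
  rewrite -mulrnA mulnC -e -[LHS]mulr_natr -[RHS]mulr_natr !natrM; field.
  by [].
by rewrite expi_mulrn expi_2pi expr1n.
Qed.

Definition chi (x : 'F_p) : C := omega R p ^+ x.
(** A quadratic refinement of the additive character: its polarisation is [chi (x * y)], by
    [quadD]. *)
Definition quad (x : 'F_p) : C := tau R p ^+ (x * x)%N.

Lemma omega_exp n : omega R p ^+ n = chi n%:R.
Proof. by rewrite /chi val_Fp_nat // expr_mod // omega_expp. Qed.

(* (m + p q)^2 = m^2 + 2p (q m) + p^2 q^2, and tau^(2p) = tau^(p^2) = 1 even for
   p = 2, where tau has order 4. *)
Lemma tau_exp_sqr n : tau R p ^+ (n * n) = quad n%:R.
Proof.
rewrite /quad val_Fp_nat // {1 2}(divn_eq n p).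
set q := (n %/ p)%N; set m := (n %% p)%N.
have -> : ((q * p + m) * (q * p + m) =
           p * p * (q * q) + 2 * (p * (q * m)) + m * m)%N by ring.
rewrite exprD exprD (exprM _ (p * p)) tau_exppp expr1n mul1r (exprM _ 2) tau_sqr.
by rewrite (exprM _ p) omega_expp expr1n mul1r.
Qed.

Lemma chi0 : chi 0 = 1.
Proof. by []. Qed.

Lemma chiD x y : chi (x + y) = chi x * chi y.
Proof.
by rewrite -[x]natr_Zp -[y]natr_Zp -natrD -!omega_exp exprD.
Qed.

Lemma normr_chi x : `|chi x| = 1.
Proof. by rewrite normrX normr_expi expr1n. Qed.

Lemma chi_neq0 x : chi x != 0.
Proof. by rewrite -normr_eq0 normr_chi oner_eq0. Qed.

Lemma conj_chi x : (chi x)^* = chi (- x).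
Proof.
apply: (mulfI (chi_neq0 x)); rewrite -normCK normr_chi expr1n.
by rewrite -chiD subrr chi0.
Qed.

Lemma chi_neq1 x : x != 0 -> chi x != 1.
Proof.
move=> x0; rewrite /chi /omega -expi_mulrn; apply: expi_neq1.
have xgt : (0 < x)%N by rewrite lt0n.
have xlt : (x < p)%N by rewrite -[X in (_ < X)%N](Fp_cast hp).
have pR_gt0 : 0 < p%:R :> R by rewrite ltr0n.
rewrite -[_ *+ x]mulr_natr -[pi *+ 2]mulr_natl; apply/andP; split.
  by rewrite !mulr_gt0 ?invr_gt0 ?pi_gt0 ?ltr0n.
rewrite -mulrA gtr_pMr ?mulr_gt0 ?pi_gt0 //.
by rewrite mulrC ltr_pdivrMr // mul1r ltr_nat.
Qed.

Lemma quadD x y : quad (x + y) = quad x * quad y * chi (x * y).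
Proof.
rewrite -[x]natr_Zp -[y]natr_Zp -natrD -natrM -!tau_exp_sqr -omega_exp.
rewrite -tau_sqr -exprM -!exprD; congr (_ ^+ _).
by ring.
Qed.

Lemma normr_quadX x n : `|quad x ^+ n| = 1.
Proof. by rewrite !normrX normr_expi !expr1n. Qed.

Lemma normr_tau n : `|tau R p ^+ n| = 1.
Proof. by rewrite normrX normr_expi expr1n. Qed.

Lemma sum_chi y : \sum_(x : 'F_p) chi (x * y) = p%:R * (y == 0)%:R.
Proof.
have [->|y0] := eqVneq y 0.
  under eq_bigr do rewrite mulr0 chi0.
  by rewrite sumr_const card_Fp // mulr1.
rewrite mulr0; set S := \sum_x _.
(* Translating the summation index by 1 multiplies the sum by [chi y], which differs from 1. *)
have : S * chi y = S.
  rewrite [RHS](reindex_inj (addIr 1)) /= mulr_suml.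
  by apply: eq_bigr => x _; rewrite mulrDl mul1r chiD.
move/eqP; rewrite -subr_eq0 -{2}[S]mulr1 -mulrBr mulf_eq0 subr_eq0.
by rewrite (negbTE (chi_neq1 _ y0)) orbF => /eqP.
Qed.

(* The index set 'I_p of the matrices and the field 'F_p are only
   propositionally equal; these two maps identify them. *)
Definition resF (i : 'I_p) : 'F_p := (nat_of_ord i)%:R.
Definition ordF (x : 'F_p) : 'I_p := cast_ord (Fp_cast hp) x.

Lemma resFK : cancel resF ordF.
Proof.
by move=> i; apply: val_inj; rewrite /= val_Fp_nat // modn_small.
Qed.

Lemma ordFK : cancel ordF resF.
Proof. by move=> x; rewrite /resF /= natr_Zp. Qed.

Lemma sum_ordF (f : 'I_p -> C) : \sum_i f i = \sum_x f (ordF x).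
Proof. by apply: reindex; exists resF => i _; rewrite ?ordFK ?resFK. Qed.

Lemma sum_resF (f : 'F_p -> C) : \sum_i f (resF i) = \sum_x f x.
Proof. by rewrite sum_ordF; apply: eq_bigr => x _; rewrite ordFK. Qed.

(** Displacement operators are monomial matrices, so this collapses the inner sum of each product
    with one of them. *)
Lemma sum_delta (x : 'F_p) (f : 'I_p -> C) :
  \sum_i (resF i == x)%:R * f i = f (ordF x).
Proof.
rewrite (bigD1 (ordF x)) //= ordFK eqxx mul1r big1 ?addr0 // => i.
by rewrite -(can_eq resFK) ordFK => /negbTE ->; rewrite mul0r.
Qed.

Lemma eq_resF (i : 'I_p) n : (nat_of_ord i == n %% p)%N = (resF i == n%:R).
Proof.
rewrite -(inj_eq val_inj) /= /resF !val_Fp_nat //.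
by rewrite [X in _ = (X == _)]modn_small.
Qed.

(** * Matrix entries of the displacement operators *)

Lemma mxpow_XopE n i j : mxpow (Xop R p) n i j = (resF i == resF j + n%:R)%:R.
Proof.
elim: n i => [|n IHn] i.
  by rewrite /= mxE addr0 (can_eq resFK).
rewrite /= mxE; under eq_bigr => k _ do
  rewrite IHn mxE mulrC eq_resF.
by rewrite sum_delta -natr1 -/(resF _) ordFK -natr1 addrA.
Qed.

Lemma mxpow_ZopE n i j :
  mxpow (Zop R p) n i j = (i == j)%:R * chi (resF j * n%:R).
Proof.
elim: n i => [|n IHn] i.
  by rewrite /= mxE mulr0 chi0 mulr1.
rewrite /= mxE (bigD1 i) //= big1 => [|k /negbTE ki]; last first.
  by rewrite mxE eq_sym ki !mul0r.
rewrite addr0 IHn mxE eqxx mul1r omega_exp -/(resF _).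
have [->|_] := eqVneq i j; last by rewrite !mul0r mulr0.
by rewrite !mul1r -chiD -natr1 mulrDr mulr1 addrC.
Qed.

Lemma DopE u i j : D u i j =
  tau R p ^+ (u.1 * u.2)%N *
  ((resF i == resF j + u.1)%:R * chi (resF j * u.2)).
Proof.
rewrite mxE; congr (_ * _); rewrite mxE (bigD1 j) //= big1 => [|k /negbTE kj].
  by rewrite addr0 mxpow_XopE mxpow_ZopE eqxx mul1r !natr_Zp.
by rewrite mxpow_ZopE kj mul0r mulr0.
Qed.

(** * Adjoints, and products of displacement operators up to phase *)

Lemma ctrmxE m n (A : 'M[C]_(m, n)) i j : A^H i j = (A j i)^*.
Proof. by rewrite !mxE. Qed.

Lemma ctrmxM m n q (A : 'M[C]_(m, n)) (B : 'M[C]_(n, q)) : (A *m B)^H = B^H *m A^H.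
Proof. by rewrite trmx_mul map_mxM. Qed.

Lemma ctrmxZ m n (c : C) (A : 'M[C]_(m, n)) : (c *: A)^H = c^* *: A^H.
Proof. by apply/matrixP=> i j; rewrite !mxE rmorphM. Qed.

Lemma ctrmxK m n (A : 'M[C]_(m, n)) : (A^H)^H = A.
Proof. by apply/matrixP=> i j; rewrite !mxE conjCK. Qed.

Lemma phase_adj (c : C) : `|c| = 1 -> c^* * c = 1.
Proof. by move=> c1; rewrite mulrC -normCK c1 expr1n. Qed.

Lemma DopM u v : exists2 c, `|c| = 1 & D u *m D v = c *: D (u + v).
Proof.
set s := tau R p ^+ (u.1 * u.2)%N; set t := tau R p ^+ (v.1 * v.2)%N.
set w := tau R p ^+ ((u + v)%R.1 * (u + v)%R.2)%N.
have w0 : w != 0 by rewrite -normr_eq0 normr_tau oner_eq0.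
(* The relation Z^b X^a = omega^(ab) X^a Z^b supplies the [chi] factor. The powers of tau stay a
   quotient, their exponents being products of residues taken in nat. *)
exists (s * t / w * chi (v.1 * u.2)).
  by rewrite !normrM normfV !normr_tau normr_chi invr1 !mulr1.
apply/matrixP=> i j; rewrite mxE [RHS]mxE [D (u + v) i j]DopE -/w.
rewrite (eq_bigr (fun k => (resF k == resF j + v.1)%:R * (s * t *
   ((resF i == resF k + u.1)%:R * (chi (resF k * u.2) * chi (resF j * v.2)))))).
  rewrite sum_delta ordFK -chiD /= [u.1 + v.1]addrC addrA.
  case: (_ == _); last by rewrite !mul0r !mulr0.
  rewrite !mul1r -mulrA [_ * chi _]mulrC.
  have -> : (resF j + v.1) * u.2 + resF j * v.2 = v.1 * u.2 + resF j * (u.2 + v.2).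
    by ring.
  by rewrite chiD; field.
by move=> k _; rewrite !DopE -/s -/t; ring.
Qed.

Lemma Dop0 : D 0 = 1%:M.
Proof.
apply/matrixP=> i j; rewrite DopE mxE /= expr0 mul1r addr0 mulr0 chi0 mulr1.
by rewrite (can_eq resFK).
Qed.

(** * Completeness and orthogonality of the displacement operators *)

(** The sum over the exponent of Z is a character sum that forces j = l; the exponent of X must
    equal both i - j and k - l, which then forces i = k. *)
Lemma sum_Dop_entries i j k l :
  \sum_u (D u i j)^* * D u k l = p%:R * ((i == k)%:R * (j == l)%:R).
Proof.
rewrite -(pair_big xpredT xpredT (fun a b => (D (a, b) i j)^* * D (a, b) k l)) /=.
rewrite (eq_bigr (fun a => (resF i == resF j + a)%:R *
   ((resF k == resF l + a)%:R * \sum_b chi (b * (resF l - resF j))))); last first.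
  move=> a _; rewrite !mulr_sumr; apply: eq_bigr => b _.
  rewrite !DopE /= !rmorphM /= !rmorph_nat conj_chi.
  set t := tau R p ^+ _.
  have -> : b * (resF l - resF j) = - (resF j * b) + resF l * b by ring.
  rewrite chiD -[RHS]mul1r -(phase_adj t) ?normr_tau //; ring.
under eq_bigr => a _ do rewrite sum_chi subr_eq0 (can_eq resFK) (eq_sym l j).
rewrite (bigD1 (resF i - resF j)) //= big1 => [|a ne /=]; last first.
  have /negbTE -> : resF i != resF j + a; last by rewrite mul0r.
  by apply: contra ne => /eqP ->; rewrite addrAC subrr add0r.
rewrite addr0 [_ + (_ - _)]addrC subrK eqxx mul1r.
have [<-|_] := eqVneq j l; last by rewrite !mulr0.
by rewrite addrC subrK (can_eq resFK) eq_sym !mulr1 mulrC.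
Qed.

(** Summing over u first contracts A with the completeness relation, which leaves only the diagonal
    of A. *)
Lemma Dop_twirl (A : 'M[C]_p) :
  \sum_u (D u)^H *m A *m D u = (p%:R * \tr A)%:M.
Proof.
apply/matrixP=> j l; rewrite summxE.
rewrite (eq_bigr (fun u => \sum_k \sum_i A i k * ((D u i j)^* * D u k l))); last first.
  move=> u _; rewrite mxE; apply: eq_bigr => k _; rewrite mxE mulr_suml.
  by apply: eq_bigr => i _; rewrite ctrmxE; ring.
rewrite exchange_big /= (eq_bigr (fun k => p%:R * (j == l)%:R * A k k)).
  by rewrite -mulr_sumr mxE -/(\tr A); case: eqP; rewrite ?mulr1 ?mulr1n // mulr0n mulr0 mul0r.
move=> k _; rewrite exchange_big /=.
under eq_bigr => i _ do rewrite -mulr_sumr sum_Dop_entries.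
rewrite (bigD1 k) //= big1 => [|i /negbTE ->]; last by rewrite mul0r !mulr0.
by rewrite eqxx addr0 mul1r mulrC.
Qed.

Lemma tr_Dop u : \tr (D u) = p%:R * (u == 0)%:R.
Proof.
case: u => a b; rewrite /mxtrace; under eq_bigr do rewrite DopE /=.
rewrite -mulr_sumr.
have [->|a0] := eqVneq a 0; last first.
  rewrite big1 ?mulr0.
    by rewrite -pair_eqE /= (negbTE a0) mulr0.
  move=> i _; have /negbTE -> : resF i != resF i + a; last by rewrite mul0r.
  by rewrite -subr_eq0 opprD addNKr oppr_eq0.
under eq_bigr do rewrite addr0 eqxx mul1r.
by rewrite (sum_resF (fun x => chi (x * b))) sum_chi mul0n mul1r -pair_eqE.
Qed.

Lemma Dop_unitary u : (D u)^H *m D u = 1%:M.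
Proof.
apply/matrixP=> i j; rewrite mxE.
rewrite (eq_bigr (fun k => (resF k == resF j + u.1)%:R *
   ((resF k == resF i + u.1)%:R * chi (resF j * u.2 - resF i * u.2)))).
  rewrite sum_delta ordFK (inj_eq (addIr _)) (can_eq resFK) mxE eq_sym.
  by case: eqP => [->|_]; rewrite ?mul0r // subrr chi0 mulr1.
move=> k _; rewrite ctrmxE !DopE.
rewrite !rmorphM /= !rmorph_nat conj_chi chiD; set t := tau R p ^+ _.
by rewrite -[RHS]mul1r -(phase_adj t) ?normr_tau //; ring.
Qed.

Lemma adj_DopM u v : exists2 c, `|c| = 1 & (D u)^H *m D v = c *: D (v - u).
Proof.
have [c c1 e] := DopM u (v - u); exists c^-1; first by rewrite normfV c1 invr1.
have c0 : c != 0 by rewrite -normr_eq0 c1 oner_eq0.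
rewrite [u + _]addrC subrK in e.
rewrite -[D v]scale1r -(mulVf c0) -scalerA -e -scalemxAr mulmxA Dop_unitary.
by rewrite mul1mx.
Qed.

Lemma tr_adj_DopM u v : \tr ((D u)^H *m D v) = p%:R * (u == v)%:R.
Proof.
have [->|uv] := eqVneq u v; first by rewrite Dop_unitary mxtrace1 mulr1.
have [c _ ->] := adj_DopM u v.
by rewrite mxtraceZ tr_Dop subr_eq0 eq_sym (negbTE uv) !mulr0.
Qed.


(** * The action of 2 x 2 matrices on Z_p^2 *)

Definition act (G : 'M['F_p]_2) (x : 'F_p * 'F_p) : 'F_p * 'F_p :=
  (G 0 0 * x.1 + G 0 1 * x.2, G 1 0 * x.1 + G 1 1 * x.2).

Lemma act1 x : act 1%:M x = x.
Proof. by case: x => a b; rewrite /act !mxE /= !mul1r !mul0r addr0 add0r. Qed.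

Lemma mulmx2E (A B : 'M['F_p]_2) i j :
  (A *m B) i j = A i 0 * B 0 j + A i 1 * B 1 j.
Proof. by rewrite mxE big_ord_recl big_ord1; congr (_ + A _ _ * B _ _); apply: val_inj. Qed.

Lemma mxtrace2E (A : 'M['F_p]_2) : \tr A = A 0 0 + A 1 1.
Proof. by rewrite /mxtrace big_ord_recl big_ord1; congr (_ + A _ _); apply: val_inj. Qed.

Lemma det2E (A : 'M['F_p]_2) : \det A = A 0 0 * A 1 1 - A 0 1 * A 1 0.
Proof.
rewrite (expand_det_row _ 0) big_ord_recl big_ord1 /cofactor !det_mx11 !mxE.
rewrite /= expr0 expr1 mul1r mulN1r mulrN.
by congr (A _ _ * A _ _ - A _ _ * A _ _); apply: val_inj.
Qed.

Lemma actM G H x : act (G *m H) x = act G (act H x).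
Proof. by rewrite /act !mulmx2E /=; congr pair; ring. Qed.

(** As det G = 1, det (G - 1) = 2 - tr G; multiplying (G - 1) x = 0 by the adjugate of G - 1 gives
    (2 - tr G) x = 0. *)
Lemma act_fixed G : \det G = 1 -> \tr G != 2%:R ->
  forall x, act G x = x -> x = 0.
Proof.
rewrite det2E mxtrace2E => d1 t2 [x y] [/= e1 e2].
have n0 : 2%:R - (G 0 0 + G 1 1) != 0 by rewrite subr_eq0 eq_sym.
have id1 : (G 0 0 - 1) * x + G 0 1 * y = 0 by rewrite mulrBl mul1r addrAC e1 subrr.
have id2 : G 1 0 * x + (G 1 1 - 1) * y = 0 by rewrite mulrBl mul1r addrA e2 subrr.
congr pair; apply: (mulfI n0); rewrite mulr0.
  transitivity ((G 1 1 - 1) * ((G 0 0 - 1) * x + G 0 1 * y)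
    - G 0 1 * (G 1 0 * x + (G 1 1 - 1) * y)).
    by rewrite -[2%:R]/(1 + 1) -[X in X + 1 - _]d1; ring.
  by rewrite id1 id2 !mulr0 subrr.
transitivity ((G 0 0 - 1) * (G 1 0 * x + (G 1 1 - 1) * y)
  - G 1 0 * ((G 0 0 - 1) * x + G 0 1 * y)).
  by rewrite -[2%:R]/(1 + 1) -[X in X + 1 - _]d1; ring.
by rewrite id1 id2 !mulr0 subrr.
Qed.

(** * Appleby's unitaries: entries, unitarity and covariance *)

Lemma chiX x n : chi x ^+ n = chi (n%:R * x).
Proof.
elim: n => [|n IHn]; first by rewrite expr0 mul0r chi0.
by rewrite exprS IHn -chiD -natr1 mulrDl mul1r addrC.
Qed.

Let tau_neq0 : tau R p != 0.
Proof. by rewrite -normr_eq0 normr_expi oner_eq0. Qed.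

Local Notation isqrt := ((Num.sqrt (p%:R : R))%:C%C^-1 : C).

Lemma isqrt_sqr : isqrt^* * isqrt = p%:R^-1.
Proof.
rewrite fmorphV -invfM /=; congr (_^-1).
have /CrealP -> : (Num.sqrt (p%:R : R))%:C%C \is Num.real by apply/complex_realP; eexists.
by rewrite -rmorphM -expr2 sqr_sqrtr ?ler0n // rmorph_nat.
Qed.

(** The two square terms of the exponent become powers of [quad], and the even cross term becomes a
    character through tau^2 = omega. The outer exponents remain natural numbers: for p = 2, [quad]
    takes values of order 4, whose powers are not determined by a residue mod p. *)
Lemma UopE_generic (F : 'M['F_p]_2) j k : F 0 1 != 0 ->
  Uop R p F j k = isqrt *
    (quad (resF k) ^+ muln (F 0 1)^-1 (F 0 0) *
     quad (resF j) ^+ muln (F 0 1)^-1 (F 1 1) *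
     chi (- ((F 0 1)^-1 * resF j * resF k))).
Proof.
rewrite /Uop => -> /=; rewrite mxE; congr (_ * _).
set B := nat_of_ord _^-1; set a := nat_of_ord (F 0 0).
set d := nat_of_ord (F 1 1).
have -> : (B%:Z * (a%:Z * k%:Z ^+ 2 - 2 * j%:Z * k%:Z + d%:Z * j%:Z ^+ 2)) =
   ((k * k) * (B * a))%N%:Z + ((j * j) * (B * d))%N%:Z - (2 * (B * j * k))%N%:Z.
  by rewrite !PoszM; ring.
rewrite !expfzDr // -!exprnP -exprnN !(exprM _ (_ * _)%N) !tau_exp_sqr.
rewrite (exprM _ 2) tau_sqr omega_exp; congr (_ * _).
rewrite -[_^-1]mul1r -(phase_adj _ (normr_chi (B * j * k)%:R)).
by rewrite mulfK ?chi_neq0 // conj_chi !natrM natr_Zp.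
Qed.

Lemma UopE_diag (F : 'M['F_p]_2) j k : F 0 1 = 0 ->
  Uop R p F j k = (resF j == F 0 0 * resF k)%:R *
    quad (resF k) ^+ muln (F 0 0) (F 1 0).
Proof.
rewrite /Uop => -> /=; rewrite mxE eq_resF natrM natr_Zp; congr (_ * _).
by rewrite mulnC -mulnn exprM tau_exp_sqr.
Qed.


(** For beta = 0 the matrix is monomial with unimodular entries. Otherwise, in the inner product of
    columns i and k, the quadratic phases of the row index cancel and leave a character sum with
    frequency beta^-1 (i - k). *)
Lemma Uop_unitary (F : 'M['F_p]_2) : \det F = 1 -> (Uop R p F)^H *m Uop R p F = 1%:M.
Proof.
rewrite det2E => dF; apply/matrixP=> i k; rewrite mxE [RHS]mxE.
have [b0|b0] := eqVneq (F 0 1) 0.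
  have a0 : F 0 0 != 0.
    by apply: contra_eq_neq dF => ->; rewrite b0 !mul0r subrr eq_sym oner_eq0.
  under eq_bigr => j _ do rewrite ctrmxE !UopE_diag // rmorphM /= rmorph_nat -mulrA.
  rewrite sum_delta ordFK (inj_eq (mulfI a0)) (can_eq resFK).
  have [<-|_] := eqVneq i k; last by rewrite mul0r mulr0.
  by rewrite mul1r phase_adj ?normr_quadX.
set n := muln (F 0 1)^-1 (F 0 0); set B := (F 0 1)^-1.
rewrite (eq_bigr (fun j => (quad (resF i) ^+ n)^* * quad (resF k) ^+ n * p%:R^-1 *
    chi (resF j * (B * (resF i - resF k))))); last first.
  move=> j _; rewrite ctrmxE !UopE_generic // -/n -/B -isqrt_sqr.
  rewrite !rmorphM /= conj_chi opprK; set t := quad (resF j) ^+ _.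
  have -> : resF j * (B * (resF i - resF k)) =
     B * resF j * resF i - B * resF j * resF k by ring.
  have tt : t^* * t = 1 by rewrite phase_adj ?normr_quadX.
  rewrite chiD -[RHS]mul1r -tt.
  move: (quad (resF i) ^+ n) (quad (resF k) ^+ n) isqrt (chi _) (chi _) t {tt}.
  by move=> a b s w z t; ring.
rewrite -mulr_sumr (sum_resF (fun x => chi (x * _))) sum_chi.
rewrite mulf_eq0 invr_eq0 (negbTE b0) subr_eq0 (can_eq resFK) /=.
have [<-|_] := eqVneq i k; last by rewrite !mulr0.
by rewrite phase_adj ?normr_quadX // mul1r mulr1 mulVf // pnatr_eq0 -lt0n.
Qed.

(** Up to characters, U_F D_x shifts the columns of U_F by x1 and D_y U_F, with y = F x, shifts its
    rows by y1. Once [quadD] expands the shifted quadratic phases, the factors that depend on the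
    matrix indices agree, and the others make up c. *)
Lemma Uop_Dop (F : 'M['F_p]_2) x : \det F = 1 ->
  exists2 c, `|c| = 1 & Uop R p F *m D x = c *: (D (act F x) *m Uop R p F).
Proof.
rewrite det2E => dF; case: x => x1 x2.
pose s := tau R p ^+ (x1 * x2)%N.
pose y1 := F 0 0 * x1 + F 0 1 * x2; pose y2 := F 1 0 * x1 + F 1 1 * x2.
rewrite -[act F _]/(y1, y2); pose t := tau R p ^+ (y1 * y2)%N.
have t0 : t != 0 by rewrite -normr_eq0 normr_tau oner_eq0.
have UD j k : (Uop R p F *m D (x1, x2)) j k =
    s * (Uop R p F j (ordF (resF k + x1)) * chi (resF k * x2)).
  rewrite mxE (eq_bigr (fun l => (resF l == resF k + x1)%:R *
     (s * (Uop R p F j l * chi (resF k * x2))))) ?sum_delta //.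
  by move=> l _; rewrite DopE -/s /=; ring.
have DU j k : (D (y1, y2) *m Uop R p F) j k =
    t * (chi ((resF j - y1) * y2) *
         Uop R p F (ordF (resF j - y1)) k).
  rewrite mxE (eq_bigr (fun l => (resF l == resF j - y1)%:R *
     (t * (chi (resF l * y2) * Uop R p F l k)))).
    by rewrite sum_delta ordFK.
  move=> l _; rewrite DopE /= -/t -subr_eq [_ == resF l]eq_sym.
  by rewrite -!mulrA [RHS]mulrCA.
have [b0|b0] := eqVneq (F 0 1) 0.
  set n := muln (F 0 0) (F 1 0).
  have nE : n%:R = F 0 0 * F 1 0 by rewrite natrM !natr_Zp.
  exists (s / t * quad x1 ^+ n).
    by rewrite !normrM normfV !normr_tau normr_quadX invr1 !mulr1.
  apply/matrixP=> j k; rewrite UD [RHS]mxE DU !UopE_diag // !ordFK -/n.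
  have -> : y1 = F 0 0 * x1 by rewrite /y1 b0 mul0r addr0.
  rewrite mulrDr -subr_eq.
  have [e|_] := eqVneq; last by rewrite !mul0r !mulr0.
  rewrite !mul1r e quadD !exprMn chiX nE.
  have ad : F 0 0 * F 1 1 = 1 by rewrite -dF b0 mul0r subr0.
  have -> : F 0 0 * resF k * y2 =
     F 0 0 * F 1 0 * (resF k * x1) + resF k * x2.
    by rewrite -[in RHS](mul1r (resF k * x2)) -ad /y2; ring.
  rewrite chiD; clearbody s t.
  by move: (chi _) (chi _) (quad _ ^+ n) (quad _ ^+ n) => *; field.
set n := muln (F 0 1)^-1 (F 0 0); set m := muln (F 0 1)^-1 (F 1 1).
have nE : n%:R = (F 0 1)^-1 * F 0 0 by rewrite natrM !natr_Zp.
have mE : m%:R = (F 0 1)^-1 * F 1 1 by rewrite natrM !natr_Zp.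
have q0 : quad (- y1) ^+ m != 0.
  by rewrite -normr_eq0 normr_quadX oner_eq0.
(* [quad x1] comes from the column shift, [quad (- y1)] from the row shift, and [chi (y1 * y2)]
   balances the linear phases. *)
exists (s / t * (quad x1 ^+ n / quad (- y1) ^+ m * chi (y1 * y2))).
  by rewrite !normrM !normfV !normr_tau !normr_quadX normr_chi invr1 !mulr1.
apply/matrixP=> j k; rewrite UD [RHS]mxE DU !UopE_generic // !ordFK -/n -/m.
rewrite !quadD !exprMn !chiX nE mE.
set u := resF j; set v := resF k.
have e : (F 0 1)^-1 * F 0 0 * (v * x1) - (F 0 1)^-1 * u * (v + x1) + v * x2 =
  y1 * y2 + (u - y1) * y2 + (F 0 1)^-1 * F 1 1 * (u * - y1)
    - (F 0 1)^-1 * (u - y1) * v.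
  (* det F = 1 eliminates gamma as (alpha delta - 1) / beta, which leaves an identity of rational
     functions. *)
  have -> : y2 = ((F 0 0 * F 1 1 - 1) * x1) / F 0 1 + F 1 1 * x2.
    by rewrite /y2 -[X in _ * _ - X]dF; field.
  by rewrite /y1; field.
move: (congr1 chi e); rewrite !chiD => {}e.
move: e; clearbody s t u v y1 y2 m n.
move: (chi _) (chi _) (chi _) (chi _) (chi _) (chi _) (chi _).
move: (quad (- y1) ^+ m) q0 (quad _ ^+ n) (quad _ ^+ n) (quad _ ^+ m) isqrt.
move=> q q0 q1 q2 q3 r c1 c2 c3 c4 c5 c6 c7 e.
transitivity (s * r * (q1 * q2 * q3) * (c7 * c6 * c5)); first by ring.
by rewrite e; field; rewrite q0 t0.
Qed.

(** * Clifford unitaries and the modulus of their trace *)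

(** The phases are existential because the trace argument takes from them only that their modulus is
    1; products and adjoints preserve this form. *)
Definition clifford (G : 'M['F_p]_2) (W : 'M[C]_p) :=
  W^H *m W = 1%:M /\
  forall x, exists2 c, `|c| = 1 & W *m D x = c *: (D (act G x) *m W).

Lemma clifford_mul G H V W :
  clifford G V -> clifford H W -> clifford (G *m H) (V *m W).
Proof.
move=> [uV cV] [uW cW]; split.
  by rewrite ctrmxM mulmxA -(mulmxA _ V^H) uV mulmx1.
move=> x; have [c c1 e] := cW x; have [d d1 f] := cV (act H x).
exists (c * d); first by rewrite normrM c1 d1 mulr1.
by rewrite -mulmxA e -scalemxAr (mulmxA V) f actM -scalemxAl scalerA mulmxA.
Qed.

Lemma clifford_adj G H W : G *m H = 1%:M -> clifford G W -> clifford H W^H.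
Proof.
move=> GH [uW cW]; have uW' := mulmx1C uW; split; first by rewrite ctrmxK.
move=> x; have [c c1 e] := cW (act H x); exists c^-1.
  by rewrite normfV c1 invr1.
have c0 : c != 0 by rewrite -normr_eq0 c1 oner_eq0.
have {}e : D x *m W = c^-1 *: (W *m D (act H x)).
  by rewrite e -actM GH act1 scalerA mulVf // scale1r.
rewrite -[LHS]mulmx1 -uW' mulmxA -(mulmxA _ _ W) e -scalemxAr -scalemxAl.
by rewrite mulmxA uW mul1mx.
Qed.

Lemma clifford_Dop u : clifford 1%:M (D u).
Proof.
split; first exact: Dop_unitary.
move=> x; have [c c1 e] := DopM u x; have [d d1 f] := DopM x u.
have d0 : d != 0 by rewrite -normr_eq0 d1 oner_eq0.
exists (c / d); first by rewrite normrM normfV c1 d1 divr1.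
by rewrite act1 e f scalerA divfK // addrC.
Qed.

Lemma clifford_Cop F u : \det F = 1 -> clifford F (Cop R p F u).
Proof.
move=> dF; rewrite -[F in clifford F _]mul1mx; apply: clifford_mul.
  exact: clifford_Dop.
by split; [exact: Uop_unitary | move=> x; exact: Uop_Dop].
Qed.

Lemma clifford_trace G W : clifford G W ->
  (forall x, act G x = x -> x = 0) -> `|\tr W| = 1.
Proof.
move=> [uW cW] fixG; have uW' := mulmx1C uW.
(* [f] is G - 1. Its injectivity makes the operators [D (f x)] pairwise orthogonal. *)
pose f x := act G x - x.
have f_inj : injective f.
  move=> x y; rewrite /f => /eqP e; apply/eqP; rewrite -subr_eq0; apply/eqP.
  apply: fixG; have actB : act G (x - y) = act G x - act G y.
    by rewrite /act; congr pair => /=; ring.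
  apply/eqP; rewrite actB -subr_eq0; move: e; rewrite -subr_eq0.
  by congr (_ == 0); rewrite !opprD !opprK addrACA.
have phases x : exists2 c, `|c| = 1 & (D x)^H *m W *m D x *m W^H = c *: D (f x).
  have [c c1 e] := cW x; have [d d1 g] := adj_DopM x (act G x).
  exists (c * d); first by rewrite normrM c1 d1 mulr1.
  rewrite -mulmxA -[_ *m W *m _]mulmxA [W *m (_ *m _)]mulmxA e -scalemxAl.
  by rewrite -scalemxAr -mulmxA uW' mulmx1 g scalerA.
have [c c1 e] := fin_all_exists2 phases.
pose M := (p%:R * \tr W) *: W^H.
have ME : M = \sum_x c x *: D (f x).
  rewrite /M -mul_scalar_mx -Dop_twirl mulmx_suml; apply: eq_bigr => x _.
  exact: e.
(* The squared Hilbert-Schmidt norm of M is computed twice: the expansion has p^2 orthogonal terms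
   of squared norm p, while M as a multiple of a unitary gives p^3 |tr W|^2. *)
have : \tr (M^H *m M) = p%:R ^+ 3.
  rewrite {2}ME mulmx_sumr raddf_sum /=.
  rewrite (eq_bigr (fun=> p%:R)) => [|x _].
    by rewrite sumr_const card_prod card_Fp // -[LHS]mulr_natr natrM; ring.
  have -> : M^H = \sum_y (c y)^* *: (D (f y))^H.
    rewrite ME linear_sum raddf_sum; apply: eq_bigr => y _.
    exact: ctrmxZ.
  rewrite mulmx_suml raddf_sum /= (bigD1 x) //= big1 => [|y yx].
    rewrite addr0 -scalemxAl -scalemxAr scalerA mxtraceZ tr_adj_DopM eqxx mulr1.
    by rewrite phase_adj // mul1r.
  rewrite -scalemxAl -scalemxAr scalerA mxtraceZ tr_adj_DopM (inj_eq f_inj).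
  by rewrite (negbTE yx) !mulr0.
rewrite ctrmxZ ctrmxK -scalemxAl -scalemxAr scalerA uW' mxtraceZ mxtrace1.
rewrite rmorphM /= rmorph_nat => h.
have p3 : p%:R ^+ 3 != 0 :> C by rewrite expf_eq0 pnatr_eq0 -lt0n p_gt0.
have : `|\tr W| ^+ 2 = 1.
  by rewrite normCK; apply: (mulfI p3); rewrite mulr1 -[RHS]h; ring.
by move/eqP; rewrite sqrp_eq1 ?normr_ge0 // => /eqP.
Qed.

End Weyl.

(** * Bipartite states as matrices, inner products and unbiasedness *)

Section States.
Context {R : realType} {p : nat} (hp : prime p).
Local Notation C := R[i].
Local Notation D := (Dop R p).
Local Notation isqrt := ((Num.sqrt (p%:R : R))%:C%C^-1 : C).

Let p_gt0 : (0 < p)%N := prime_gt0 hp.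

Lemma sum_mxtens (f : 'I_(p * p) -> C) :
  \sum_i f i = \sum_a \sum_b f (mxtens_index (a, b)).
Proof.
rewrite pair_big /= (reindex (@mxtens_index p p)) /=.
  by apply: eq_bigr => -[].
by exists (@mxtens_unindex p p) => i _; rewrite ?mxtens_indexK ?mxtens_unindexK.
Qed.

Lemma tensmxZr m n q r (A : 'M[C]_(m, n)) (c : C) (B : 'M[C]_(q, r)) :
  A *t (c *: B) = c *: (A *t B).
Proof.
apply/matrixP=> k l.
case: (mxtens_indexP k) => k1 k2; case: (mxtens_indexP l) => l1 l2.
by rewrite [RHS]mxE !tensmxE [in LHS]mxE mulrCA.
Qed.

(** Vectorisation: an operator on the first factor of Phi passes to the second one as its transpose,
    so such a state amounts to a single p x p matrix. *)
Lemma tensmx_Phi (A B : 'M[C]_p) i j :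
  ((A *t B) *m Phi R p) (mxtens_index (i, j)) 0 = isqrt * (B *m A^T) j i.
Proof.
rewrite /Phi -scalemxAr mxE; congr (_ * _).
rewrite mulmx_sumr summxE mxE; apply: eq_bigr => l _.
have -> : A *t B *m (ket R p l *t ket R p l) = (A *m ket R p l) *t (B *m ket R p l).
  exact: tensmx_mul.
rewrite /ket -!colE.
have e := tensmxE (col l A) (col l B) i j 0 0.
have i0 : mxtens_index (0, 0) = 0 :> 'I_(1 * 1) by apply: ord1.
by rewrite i0 in e; rewrite [LHS]e !mxE mulrC.
Qed.

Lemma tensmx_Phi_eq (A B A' B' : 'M[C]_p) : B *m A^T = B' *m A'^T ->
  (A *t B) *m Phi R p = (A' *t B') *m Phi R p.
Proof.
move=> e; apply/colP=> k; case: (mxtens_indexP k) => i j.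
by rewrite !tensmx_Phi e.
Qed.

Lemma dotc_tensmx_Phi (A B : 'M[C]_p) :
  dotc R (p * p) ((1%:M *t A) *m Phi R p) ((1%:M *t B) *m Phi R p) =
  p%:R^-1 * \tr (A^H *m B).
Proof.
rewrite /dotc sum_mxtens /mxtrace mulr_sumr; apply: eq_bigr => a _.
rewrite [in RHS]mxE mulr_sumr; apply: eq_bigr => b _.
rewrite !tensmx_Phi trmx1 !mulmx1 ctrmxE rmorphM mulrACA.
by rewrite isqrt_sqr.
Qed.

(** Cyclicity of the trace cancels U_F against its adjoint and leaves the orthogonality of the
    displacement operators. *)
Lemma dotc_Jstate F u v : \det F = 1 ->
  dotc R (p * p) (Jstate R p F u) (Jstate R p F v) = (u == v)%:R.
Proof.
move=> dF; rewrite dotc_tensmx_Phi /Cop ctrmxM mulmxA mxtrace_mulC !mulmxA.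
rewrite (mulmx1C (Uop_unitary hp F dF)) mul1mx tr_adj_DopM // mulKf //.
by rewrite pnatr_eq0 -lt0n.
Qed.

Lemma Jstate_orthonormal F : \det F = 1 ->
  orthonormal_basis R (p * p) _ (Jstate R p F).
Proof.
move=> dF; split; first by rewrite card_prod card_Fp.
by move=> u v; exact: dotc_Jstate.
Qed.

Lemma det1_unitmx (F : 'M['F_p]_2) : \det F = 1 -> F \in unitmx.
Proof. by rewrite unitmxE => ->; rewrite unitr1. Qed.

Lemma det1_invmx_mul (F G : 'M['F_p]_2) :
  \det F = 1 -> \det G = 1 -> \det (invmx F *m G) = 1.
Proof. by move=> dF dG; rewrite det_mulmx det_inv dF dG invr1 mulr1. Qed.

Lemma Jstate_unbiased F G : \det F = 1 -> \det G = 1 ->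
  \tr (invmx F *m G) != 2%:R ->
  mutually_unbiased R (p * p) _ _ (Jstate R p F) (Jstate R p G).
Proof.
move=> dF dG trFG u v; rewrite dotc_tensmx_Phi normrM.
rewrite (@clifford_trace R p hp (invmx F *m G)); first last.
- exact/act_fixed/trFG/det1_invmx_mul.
- apply: clifford_mul; last exact: clifford_Cop.
  apply: clifford_adj (clifford_Cop hp F u dF).
  exact/mulmxV/det1_unitmx.
(* The dimension is p^2, so the required modulus is 1 / p. *)
rewrite natrM -expr2 sqrtr_sqr normr_nat rmorph_nat mulr1.
by rewrite normfV normr_nat.
Qed.

(** * Maximal entanglement and stabilizers *)

Lemma Jstate_maximally_entangled F u : \det F = 1 ->
  maximally_entangled R p (Jstate R p F u).
Proof.
move=> dF; rewrite /maximally_entangled; set M := \matrix_(i, j) _.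
have -> : M = isqrt *: (Cop R p F u)^T.
  apply/matrixP=> i j; rewrite [LHS]mxE tensmx_Phi trmx1 mulmx1.
  by rewrite [RHS]mxE [in RHS]mxE.
rewrite ctrmxZ -scalemxAl -scalemxAr scalerA mulrC isqrt_sqr.
congr (_ *: _); rewrite trmxK -[map_mx _ _]trmxK -trmx_mul map_trmx.
by have [-> _] := clifford_Cop (R := R) hp F u dF; rewrite trmx1.
Qed.

(** Transposition inverts the shift X and fixes the diagonal Z; reordering Z^b X^(-a) gives the
    factor [chi (- (a * b))]. *)
Lemma trmx_Dop a : exists c, (D a)^T = c *: D (- a.1, a.2).
Proof.
case: a => a b; set s := tau R p ^+ (nat_of_ord a * nat_of_ord b)%N.
set t := tau R p ^+ (nat_of_ord (- a)%R * nat_of_ord b)%N.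
have t0 : t != 0 by rewrite -normr_eq0 normr_tau oner_eq0.
exists (s / t * chi (- (a * b))); apply/matrixP=> i j.
rewrite mxE [RHS]mxE !(DopE hp) /= -/s -/t -subr_eq [_ == resF i]eq_sym.
have [->|_] := eqVneq; last by rewrite !mul0r !mulr0.
have -> : (resF j - a) * b = - (a * b) + resF j * b by ring.
rewrite !mul1r (chiD hp); clearbody s t.
by move: (chi _) (chi _) => *; field.
Qed.

Lemma Jstate_stabilizer F u : \det F = 1 -> stabilizer_state R p (Jstate R p F u).
Proof.
move=> dF; split.
  apply/eqP=> J0; have := dotc_Jstate F u u dF.
  rewrite J0 /dotc big1 ?eqxx => [/eqP|i _]; last by rewrite mxE mulr0.
  by rewrite eq_sym oner_eq0.
(* By vectorisation D_a (x) D_b sends the matrix C of the state to D_b C D_a^T. With a' = (-a1, a2)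
   this is a multiple of D_b D_(F a') C, hence of C when b = - F a'. The free component a yields p^2
   distinct pairs. *)
exists [set (a, - act F (- a.1, a.2)) | a : 'F_p * 'F_p]; split.
  by rewrite card_imset ?card_prod ?card_Fp // => a b [].
move=> _ /imsetP[a _ ->] /=; set x := act _ _.
have [c0 e0] := trmx_Dop a.
have [c1 _ e1] := (clifford_Cop (R := R) hp F u dF).2 (- a.1, a.2).
have [c2 _ e2] := DopM (R := R) hp (- x) x.
exists (c0 * c1 * c2); rewrite mulmxA tensmx_mul mulmx1 scalemxAl -tensmxZr.
apply: tensmx_Phi_eq.
rewrite trmx1 mulmx1 e0 -scalemxAr -mulmxA e1 -scalemxAr mulmxA e2 addNr Dop0 //.
by rewrite -scalemxAl mul1mx !scalerA.
Qed.

(** * The bound on cliques *)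

(** Both matrices send (1, 0) to the same vector, so F^-1 G fixes (1, 0), and [act_fixed] excludes
    this for any other trace. *)
Lemma first_col_trace (F G : 'M['F_p]_2) : \det F = 1 -> \det G = 1 ->
  F 0 0 = G 0 0 -> F 1 0 = G 1 0 -> \tr (invmx F *m G) = 2%:R.
Proof.
move=> dF dG e0 e1; apply/eqP/contraT => trFG.
have colE H : act H (1, 0) = (H 0 0, H 1 0).
  by rewrite /act /= !mulr1 !mulr0 !addr0.
have /(act_fixed _ (det1_invmx_mul F G dF dG) trFG) [/eqP] :
    act (invmx F *m G) (1, 0) = (1, 0).
  by rewrite actM colE -e0 -e1 -colE -actM mulVmx ?det1_unitmx // act1.
by rewrite oner_eq0.
Qed.

Lemma clique_card K : is_clique _ (SL2 p) (cayley_adj p (Tset p)) K ->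
  (#|K| <= p ^ 2 - 1)%N.
Proof.
move=> [/subsetP KSL Kadj].
have detK F : F \in K -> \det F = 1 by move/KSL; rewrite inE => /eqP.
pose f (F : 'M['F_p]_2) := (F 0 0, F 1 0).
have f_inj : {in K &, injective f}.
  move=> F G FK GK [e0 e1]; apply/eqP/contraT => /(Kadj _ _ FK GK).
  by rewrite /cayley_adj inE first_col_trace ?detK // eqxx andbF.
rewrite -(card_in_imset f_inj).
(* The zero column is excluded by the determinant, whence the - 1. *)
have -> : (p ^ 2 - 1)%N = #|[set~ (0 : 'F_p * 'F_p)]|.
  by rewrite cardsC1 card_prod card_Fp // subn1 mulnn.
apply/subset_leq_card/subsetP => _ /imsetP[F FK ->]; rewrite !inE.
apply/eqP => -[a0 c0]; have := detK F FK.
by rewrite det2E a0 c0 mul0r mulr0 subrr => /eqP; rewrite eq_sym oner_eq0.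
Qed.
End States.

Theorem theorem1 (R : realType) (p : nat) (hp : prime p) :
  (forall F, F \in SL2 p -> orthonormal_basis R (p * p) _ (Jstate R p F)) /\
  (forall F1 F2, F1 \in SL2 p -> F2 \in SL2 p ->
     \tr (invmx F1 *m F2) != 2%:R ->
     mutually_unbiased R (p * p) _ _ (Jstate R p F1) (Jstate R p F2)) /\
  (forall Fam : {set 'M['F_p]_2},
     Fam \subset SL2 p -> #|Fam| = (p ^ 2 - 1)%N ->
     (forall Fi Fj, Fi \in Fam -> Fj \in Fam -> Fi != Fj ->
        \tr (invmx Fi *m Fj) != 2%:R) ->
     complete_BES_MUB R p Fam (Jstate R p) /\
     is_maximum_clique _ (SL2 p) (cayley_adj p (Tset p)) Fam).
Proof.
have detE F : F \in SL2 p -> \det F = 1 by rewrite inE => /eqP.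
split; first by move=> F /detE; exact: Jstate_orthonormal.
split; first by move=> F G /detE dF /detE dG; exact: Jstate_unbiased.
move=> Fam FamSL cardFam trFam.
have detFam F : F \in Fam -> \det F = 1 by move/(subsetP FamSL)/detE.
split.
  split=> //; split; first by move=> F /detFam; exact: Jstate_orthonormal.
  split=> [F G FF GF FG|F u /detFam dF].
    by apply: Jstate_unbiased; rewrite ?detFam ?trFam.
  by split; [exact: Jstate_maximally_entangled | exact: Jstate_stabilizer].
(* The family attains the bound valid for every clique. *)
split; last by move=> K /clique_card; rewrite cardFam; apply.
split=> // F G FF GF FG.
by rewrite /cayley_adj !inE trFam // andbT det1_invmx_mul ?detFam.
Qed.
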